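(* Let $G:[0,\infty)\to[0,\infty)$ be a Bernstein function and define $F(\lambda) := G(\lambda^2)$ for $\lambda \ge 0$. Then for any pair of independent, identically distributed real-valued random variables $X, Y$, $$\mathbb{E}\, F(|X-Y|) \le \mathbb{E}\, F(|X+Y|).$$
   Context: A function $G:[0,\infty)\to[0,\infty)$ is called a Bernstein function if it admits a representation $$G(\lambda) = a + b\lambda + \int_0^\infty \left(1-e^{-t\lambda}\right)\mu(dt), \qquad \lambda \ge 0,$$ where $a, b \ge 0$ and $\mu$ is a (nonnegative Borel) measure on $(0,\infty)$ satisfying $\int_0^\infty \min(t,1)\,\mu(dt) < \infty$. No integrability assumption is imposed on $X, Y$; since $F \ge 0$, both expectations are well defined as elements of $[0,\infty]$, and the inequality is understood in $[0,\infty]$. *)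

(* Defs.v *)
From HB Require Import structures.
From mathcomp Require Export all_boot all_order all_algebra.
From mathcomp Require Export all_classical all_reals all_analysis.
Export Order.TTheory GRing.Theory Num.Theory.
Export numFieldNormedType.Exports.

Set Implicit Arguments.
Unset Strict Implicit.
Unset Printing Implicit Defensive.

Local Open Scope classical_set_scope.
Local Open Scope ring_scope.
Local Open Scope ereal_scope.

(* [mu] is a Borel measure on the whole line, but only its restriction to
   (0, +oo) enters: these restrictions are exactly the Borel measures on
   (0, +oo).  No finiteness is assumed of [mu] beyond the integrability of
   min(t, 1). *)
Definition bernstein (R : realType) (G : {nonneg R} -> {nonneg R}) : Prop :=
  exists (a b : R) (mu : {measure set R -> \bar R}),
    [/\ (0 <= a)%R, (0 <= b)%R,
        \int[mu]_(t in `]0%R, +oo[) (Num.min t 1)%:E < +oo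
      & forall l : {nonneg R},
          (G l)%:num%:E = a%:E + (b * l%:num)%:E
            + \int[mu]_(t in `]0%R, +oo[) (1 - expR (- (t * l%:num)))%:E].

(* In the next two definitions the restriction to measurable sets is essential:
   a measure is a total function on [set T], with unconstrained values on
   nonmeasurable sets. *)
Definition independent_RV d (T : measurableType d) (R : realType)
    (P : probability T R) (X Y : {RV P >-> R}) : Prop :=
  forall A B : set R, measurable A -> measurable B ->
    P ((X @^-1` A) `&` (Y @^-1` B)) = P (X @^-1` A) * P (Y @^-1` B).

Definition identically_distributed d (T : measurableType d) (R : realType)
    (P : probability T R) (X Y : {RV P >-> R}) : Prop :=
  forall A : set R, measurable A -> distribution P X A = distribution P Y A.

(* Main.v *)
From HB Require Import structures.
Require Import Defs.
From mathcomp Require Import measurable_realfun ring lra.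

(** Up to a constant, [exp(- t (x - y)^2)] is the integral over [u] of
    [phi_u(x) phi_u(y)], where [phi_u(x) = exp(- 2 t (x - u)^2)].  With
    [f(u) = E phi_u(X)] and [h(u) = E phi_u(- X)] this gives
    [E exp(- t (X - Y)^2) = C int f^2 = C int h^2] and
    [E exp(- t (X + Y)^2) = C int f h], so by AM-GM the Laplace transform of
    [(X + Y)^2] is at most that of [(X - Y)^2].  A Bernstein function is a
    constant, plus a multiple of the identity, plus a mixture of the functions
    [1 - exp(- t z)]: the mixture is handled by Tonelli's theorem and the
    identity, being the limit of [n (1 - exp(- z / n))], by Fatou's lemma, which
    needs no integrability of [X]. *)

Set Implicit Arguments.
Unset Strict Implicit.
Unset Printing Implicit Defensive.

Local Open Scope classical_set_scope.
Local Open Scope ring_scope.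

(** * Expectations over an independent, identically distributed pair *)

(** The joint law agrees with the product of the marginals on rectangles, hence everywhere by
    uniqueness of the product measure; Tonelli's theorem then splits the integral. *)
Lemma ge0_integral_iid (R : realType) d (T : measurableType d)
    (P : probability T R) (X Y : {RV P >-> R}) (f : R * R -> \bar R) :
  independent_RV X Y -> identically_distributed X Y ->
  measurable_fun setT f -> (forall z, 0 <= f z)%E ->
  (\int[P]_w f (X w, Y w) =
   \int[distribution P X]_x \int[distribution P X]_y f (x, y))%E.
Proof.
move=> indXY idXY mf f0.
have mXY : measurable_fun setT (fun w => (X w, Y w)).
  by apply/measurable_fun_pairP; split.
rewrite -(fubini_tonelli1 f)//.
transitivity (\int[pushforward P (fun w => (X w, Y w))]_z f z)%E.
  by rewrite (ge0_integral_pushforward mXY).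
pose mXY_mixin := isMeasurableFun.Build _ _ _ _ _ mXY.
pose XY : {mfun T >-> (R * R)%type} := HB.pack (fun w => (X w, Y w)) mXY_mixin.
apply: (@eq_measure_integral _ _ _ _ _ (pushforward P XY)) => A mA _.
apply/esym; apply: product_measure_unique => // B C mB mC.
transitivity (distribution P X B * distribution P Y C)%E; first exact: indXY.
by rewrite -idXY.
Qed.

(** * Gaussian integrals and the comparison of Laplace transforms *)

Lemma integral_gaussian (R : realType) (c : R) : 0 < c ->
  exists2 K : R, 0 < K & forall m,
    (\int[lebesgue_measure]_u (expR (- (c * (u - m) ^+ 2)))%:E = K%:E)%E.
Proof.
(* With [2 s^2 = 1 / c] the integrand is the normal density of mean [m] divided by its peak value,
   so the integral does not depend on [m]. *)
move=> c0; pose s := Num.sqrt (c^-1 / 2).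
have s2 : s ^+ 2 = c^-1 / 2 by rewrite sqr_sqrtr// divr_ge0// invr_ge0 ltW.
have s0 : s != 0 by rewrite gt_eqF// sqrtr_gt0 divr_gt0// invr_gt0.
have p0 := normal_peak_gt0 s0.
exists (normal_peak s)^-1 => [|m]; first by rewrite invr_gt0.
under eq_integral.
  move=> u _.
  rewrite (_ : expR _ = (normal_peak s)^-1 * normal_pdf m s u); last first.
    rewrite normal_pdfE// mulKf ?gt_eqF// /normal_fun s2.
    by congr expR; field; rewrite gt_eqF.
  rewrite EFinM.
  over.
rewrite ge0_integralZl_EFin//.
- by rewrite integral_normal_pdf mule1.
- by move=> u _; rewrite lee_fin normal_pdf_ge0.
- by apply/measurable_EFinP; exact: measurable_normal_pdf.
- by rewrite invr_ge0 ltW.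
Qed.

Lemma measurable_expR_sqrB (R : realType) d (T : measurableType d)
    (a b : T -> R) (c : R) : measurable_fun setT a -> measurable_fun setT b ->
  measurable_fun setT (fun w => expR (- (c * (a w - b w) ^+ 2))).
Proof.
move=> ma mb; apply: measurableT_comp => //; apply: measurableT_comp => //.
by apply: measurable_funM => //; apply: measurable_funX; exact: measurable_funB.
Qed.

(* Completing the square:
   [2 (u - x)^2 + 2 (u - y)^2 = 4 (u - (x + y) / 2)^2 + (x - y)^2]. *)
Lemma gaussian_kernel_factor (R : realType) (t : R) : 0 < t ->
  exists2 K : R, 0 < K & forall (nu : probability R R) (g h : R -> R),
    measurable_fun setT g -> measurable_fun setT h ->
    (K%:E * \int[nu]_x \int[nu]_y (expR (- (t * (g x - h y) ^+ 2)))%:E =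
     \int[lebesgue_measure]_u
       ((\int[nu]_x (expR (- (t * 2 * (g x - u) ^+ 2)))%:E) *
        (\int[nu]_y (expR (- (t * 2 * (h y - u) ^+ 2)))%:E)))%E.
Proof.
(* The rate [4 t] is that of the Gaussian in [u] left after completing the square. *)
move=> t0; have [|K K0 KE] := @integral_gaussian R (t * 4).
  by rewrite mulr_gt0.
exists K => // nu g h mg mh.
pose leb : {sigma_finite_measure set (measurableTypeR R) -> \bar R} :=
  @lebesgue_measure R.
pose phi (k : R -> R) (z : R * R) : \bar R :=
  (expR (- (t * 2 * (k z.1 - z.2) ^+ 2)))%:E.
have phi0 k z : (0 <= phi k z)%E by rewrite lee_fin expR_ge0.
have mphi k : measurable_fun setT k -> measurable_fun setT (phi k).
  move=> mk; apply/measurable_EFinP; apply: measurable_expR_sqrB => //.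
  exact: measurableT_comp.
pose H k u := (\int[nu]_y phi k (y, u))%E.
have H0 k u : (0 <= H k u)%E by exact: integral_ge0.
have mH k : measurable_fun setT k -> measurable_fun setT (H k).
  move=> mk.
  by apply: (measurable_fun_fubini_tonelli_G (phi k)); [exact: mphi|].
have mphi1 k x : measurable_fun setT (fun u => phi k (x, u)).
  apply/measurable_EFinP.
  exact: (@measurable_expR_sqrB _ _ _ (cst (k x)) id).
have mphi2 k u : measurable_fun setT k ->
    measurable_fun setT (fun y => phi k (y, u)).
  move=> mk; apply/measurable_EFinP.
  exact: (@measurable_expR_sqrB _ _ _ k (cst u)).
transitivity (\int[nu]_x \int[nu]_y \int[leb]_u
    (phi g (x, u) * phi h (y, u)))%E.
  pose psi (z : R * R) : \bar R := (expR (- (t * (g z.1 - h z.2) ^+ 2)))%:E.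
  have psi0 z : (0 <= psi z)%E by rewrite lee_fin expR_ge0.
  have mpsi : measurable_fun setT psi.
    apply/measurable_EFinP.
    by apply: measurable_expR_sqrB; exact: measurableT_comp.
  rewrite -ge0_integralZl_EFin//; first last.
  - exact: ltW.
  - exact: (measurable_fun_fubini_tonelli_F psi).
  - by move=> x _; exact: integral_ge0.
  apply: eq_integral => x _.
  rewrite -ge0_integralZl_EFin//; first last.
  - exact: ltW.
  - apply/measurable_EFinP.
    exact: (@measurable_expR_sqrB _ _ _ (cst (g x)) h).
  apply: eq_integral => y _.
  (* Since [K] is the Gaussian integral for every centre, the midpoint required by the completed
     square may be chosen separately for each pair [(x, y)]. *)
  rewrite -(KE ((g x + h y) / 2)) muleC -ge0_integralZl_EFin; first last.
  - exact: expR_ge0.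
  - apply/measurable_EFinP.
    under eq_fun do rewrite -sqrrN opprB.
    exact: (@measurable_expR_sqrB _ _ _ (cst ((g x + h y) / 2)) id).
  - by move=> u _; rewrite lee_fin expR_ge0.
  - exact: measurableT.
  apply: eq_integral => u _.
  by rewrite /phi/= -!EFinM -!expRD; congr (expR _)%:E; field.
(* Tonelli's theorem moves the integral over [u] outwards, first past [y], then past [x]. *)
transitivity (\int[nu]_x \int[leb]_u (phi g (x, u) * H h u))%E.
  apply: eq_integral => x _.
  have := @fubini_tonelli _ _ _ _ _ nu leb
    (fun z : R * R => phi g (x, z.2) * phi h z)%E.
  move=> /= -> //=.
  - by apply: eq_integral => u _; rewrite ge0_integralZl//; exact: mphi2.
  - apply: emeasurable_funM; last exact: mphi.
    by apply: (measurableT_comp (mphi1 g x)).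
  - by move=> z; rewrite mule_ge0.
have := @fubini_tonelli _ _ _ _ _ nu leb (fun z : R * R => phi g z * H h z.2)%E.
move=> /= -> //=.
- by apply: eq_integral => u _; rewrite ge0_integralZr//; exact: mphi2.
- apply: emeasurable_funM; first exact: mphi.
  by apply: measurableT_comp => //; exact: mH.
- by move=> z; rewrite mule_ge0.
Qed.

Lemma integral_gaussian_add_le_sub (R : realType) (nu : probability R R)
    (t : R) : 0 < t ->
  (\int[nu]_x \int[nu]_y (expR (- (t * (x + y) ^+ 2)))%:E <=
   \int[nu]_x \int[nu]_y (expR (- (t * (x - y) ^+ 2)))%:E)%E.
Proof.
move=> t0.
have [K K0 KE] := gaussian_kernel_factor t0.
have mid : measurable_fun setT (@id R) by [].
have mopp : measurable_fun setT (-%R : R -> R) by [].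
pose H (k : R -> R) u := (\int[nu]_x (expR (- (t * 2 * (k x - u) ^+ 2)))%:E)%E.
have H0 k u : (0 <= H k u)%E.
  by apply: integral_ge0 => x _; rewrite lee_fin expR_ge0.
have mH k : measurable_fun setT k -> measurable_fun setT (H k).
  move=> mk; apply: (measurable_fun_fubini_tonelli_G (fun z : R * R =>
    (expR (- (t * 2 * (k z.1 - z.2) ^+ 2)))%:E)).
    apply/measurable_EFinP; apply: measurable_expR_sqrB => //.
    exact: measurableT_comp.
  by move=> z; rewrite lee_fin expR_ge0.
have amgm (a b : \bar R) : (0 <= a -> 0 <= b ->
    2%:E * (a * b) <= a * a + b * b)%E.
  move: a b => [a| |] [b| |]//= a0 b0; rewrite ?leey//.
    rewrite -!EFinM -EFinD lee_fin; have := sqr_ge0 (a - b); nra.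
set A := (leLHS); set B := leRHS.
have EA : (K%:E * A = \int[lebesgue_measure]_u (H id u * H -%R u))%E.
  apply: etrans; last exact: (KE nu id -%R mid mopp).
  apply: (congr1 (mule K%:E)).
  apply: eq_integral => x _; apply: eq_integral => y _.
  by rewrite /= opprK.
have EB : (K%:E * B = \int[lebesgue_measure]_u (H id u * H id u))%E.
  exact: KE.
(* [x - y] and [(- x) - (- y)] have the same square, so reflection gives a second expression for
   [K * B]. *)
have EB' : (K%:E * B = \int[lebesgue_measure]_u (H -%R u * H -%R u))%E.
  apply: etrans; last exact: (KE nu -%R -%R mopp mopp).
  apply: (congr1 (mule K%:E)).
  apply: eq_integral => x _; apply: eq_integral => y _.
  by rewrite /= -opprD sqrrN.
move: A B EA EB EB' => A B EA EB EB'.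
rewrite -(@lee_pmul2l _ (2 * K)%:E)//; last by rewrite lte_fin mulr_gt0.
have mprod k l : measurable_fun setT k -> measurable_fun setT l ->
    measurable_fun setT (fun u => H k u * H l u)%E.
  by move=> mk ml; apply: emeasurable_funM; exact: mH.
have prod0 k l u : (0 <= H k u * H l u)%E by exact: mule_ge0.
(* Of the two copies of [K * B], one is expanded with [H id] and the other with [H -%R], so that
   AM-GM applies pointwise in [u]. *)
rewrite EFinM -!muleA EA [leRHS]mule_natl mule2n {1}EB EB'.
rewrite -ge0_integralD//; [|exact: mprod..].
rewrite -ge0_integralZl_EFin//; last exact: mprod.
apply: ge0_le_integral => //.
- by move=> u _; rewrite mule_ge0.
- by apply: measurable_funeM; exact: mprod.
- by apply: emeasurable_funD; exact: mprod.
- by move=> u _; exact: amgm.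
Qed.

Lemma laplace_sqr_add_le_sub (R : realType) d (T : measurableType d)
    (P : probability T R) (X Y : {RV P >-> R}) (t : R) :
  independent_RV X Y -> identically_distributed X Y -> 0 < t ->
  (\int[P]_w (expR (- (t * (X w + Y w) ^+ 2)))%:E <=
   \int[P]_w (expR (- (t * (X w - Y w) ^+ 2)))%:E)%E.
Proof.
move=> indXY idXY t0.
have Eadd := ge0_integral_iid (f := fun z : R * R =>
  (expR (- (t * (z.1 + z.2) ^+ 2)))%:E) indXY idXY.
have Esub := ge0_integral_iid (f := fun z : R * R =>
  (expR (- (t * (z.1 - z.2) ^+ 2)))%:E) indXY idXY.
rewrite [leLHS]Eadd; first last.
- by move=> z; rewrite lee_fin expR_ge0.
- apply/measurable_EFinP.
  under eq_fun do rewrite -[X in _ + X]opprK.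
  by apply: measurable_expR_sqrB => //; exact: measurableT_comp.
rewrite [leRHS]Esub; first last.
- by move=> z; rewrite lee_fin expR_ge0.
- by apply/measurable_EFinP; exact: measurable_expR_sqrB.
exact: integral_gaussian_add_le_sub.
Qed.

(** * From Laplace transforms to Bernstein functions *)

(** This makes Tonelli's theorem available for the mixture. Away from zero the mass is finite by
    Markov's inequality: [min(t, 1)] is at least [1 / (n + 1)] on []1 / (n + 1), +oo[]. *)
Lemma sigma_finite_mrestr_gt0 (R : realType) (mu : {measure set R -> \bar R}) :
  (\int[mu]_(t in `]0%R, +oo[) (Num.min t 1)%:E < +oo)%E ->
  sigma_finite setT
    (mrestr mu (measurable_itv (Interval (BRight (0 : R)) +oo%O))).
Proof.
(* Taking complements also covers the half-line [t <= 0], which is null for the restricted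
   measure. *)
move=> mu_fin; exists (fun n => ~` `]0, n.+1%:R^-1]).
  apply/esym; rewrite -subTset => t _.
  have [t0|t0] := leP t 0; first by exists 0%N; rewrite //= in_itv/= ltNge t0.
  pose n := Num.truncn t^-1; exists n => //=; apply/negP.
  rewrite in_itv/= t0/= -ltNge.
  rewrite invf_plt ?posrE//.
  exact: truncnS_gt.
move=> n; split; first exact: measurableC.
rewrite /mrestr (_ : _ `&` _ = `]n.+1%:R^-1, +oo[%classic); last first.
  apply/seteqP; split=> t/=; rewrite !in_itv/= !andbT.
    by move=> -[/negP + t0]; rewrite t0/= -ltNge.
  have n0 : (0 : R) < n.+1%:R^-1 by rewrite invr_gt0.
  move=> nt; split; last exact: lt_trans nt.
  by apply/negP; rewrite negb_and -ltNge nt orbT.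
set F := [set` _]; have mF : measurable F by exact: measurable_itv.
have : ((n.+1%:R^-1)%:E * mu F <=
        \int[mu]_(t in `]0%R, +oo[) (Num.min t 1)%:E)%E.
  rewrite -integral_cst//.
  apply: (@le_trans _ _ (\int[mu]_(t in F) (Num.min t 1)%:E)%E).
    apply: ge0_le_integral => //.
    - by move=> t _; rewrite /= lee_fin invr_ge0.
    - by apply/measurable_EFinP; apply: measurable_minr.
    - move=> t; rewrite /F/= in_itv/= andbT => nt.
      rewrite lee_fin le_min ltW//=.
      by rewrite invf_le1// ler1n.
  apply: ge0_subset_integral => //.
  - by apply/measurable_EFinP; apply: measurable_minr.
  - move=> t/=; rewrite in_itv/= andbT => t0.
    by rewrite lee_fin le_min ler01 ltW.
  - move=> t; rewrite /F/= !in_itv/= !andbT; apply: lt_trans.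
    by rewrite invr_gt0.
(* An infinite mass of [F] would make the left-hand side infinite. *)
move=> /le_lt_trans/(_ mu_fin); rewrite !ltey; apply: contra_neq => ->.
by rewrite gt0_muley// lte_fin invr_gt0.
Qed.

(** The exponentials are bounded by 1, hence integrable under a probability, so their integrals can
    be subtracted from 1 even when [U] or [V] has infinite mean. *)
Lemma le_integral_1BexpR (R : realType) d (T : measurableType d)
    (P : probability T R) (U V : T -> R) :
  measurable_fun setT U -> measurable_fun setT V ->
  (forall w, 0 <= U w) -> (forall w, 0 <= V w) ->
  (\int[P]_w (expR (- V w))%:E <= \int[P]_w (expR (- U w))%:E)%E ->
  (\int[P]_w (1 - expR (- U w))%:E <= \int[P]_w (1 - expR (- V w))%:E)%E.
Proof.
move=> mU mV U0 V0.
have me (W : T -> R) : measurable_fun setT W ->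
    measurable_fun setT (fun w => (expR (- W w))%:E).
  by move=> mW; apply/measurable_EFinP; do 2 apply: measurableT_comp => //.
have ie (W : T -> R) : measurable_fun setT W -> (forall w, 0 <= W w) ->
    P.-integrable setT (fun w => (expR (- W w))%:E).
  move=> mW W0.
  apply: (@le_integrable _ _ _ P _ measurableT _ (cst 1%E)).
  - exact: me.
  - move=> w _; rewrite /= normr1 ger0_norm ?expR_ge0//.
    by rewrite lee_fin -expR0 ler_expR oppr_le0.
  - exact: finite_measure_integrable_cst.
have E (W : T -> R) : measurable_fun setT W -> (forall w, 0 <= W w) ->
    (\int[P]_w (1 - expR (- W w))%:E = 1 - \int[P]_w (expR (- W w))%:E)%E.
  move=> mW W0; under eq_integral do rewrite EFinB.
  rewrite integralB//; last 2 first.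
  - exact: finite_measure_integrable_cst.
  - exact: ie.
  rewrite integral_cst// mul1e; congr (_ - _)%E.
  exact: probability_setT.
by move=> VU; rewrite (E U)// (E V)// leeB.
Qed.
(* [1 + x <= exp x] gives [1 - x <= exp (- x) <= 1 / (1 + x)]. *)
Lemma expR_difference_quotient_bounds (R : realType) (z h : R) :
  0 <= z -> 0 < h -> z - h * z ^+ 2 <= h^-1 * (1 - expR (- (h * z))) <= z.
Proof.
move=> z0 h0; set x := h * z; have x0 : 0 <= x by rewrite mulr_ge0// ltW.
have zE : z = h^-1 * x by rewrite mulKf// gt_eqF.
have -> : z - h * z ^+ 2 = h^-1 * (x - x ^+ 2).
  by rewrite /x; field; rewrite gt_eqF.
rewrite [X in _ <= _ <= X]zE !ler_pM2l ?invr_gt0//.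
have h1 := expR_ge1Dx (- x).
have h2 := expR_ge1Dx x.
have h3 : expR (- x) * expR x = 1 by rewrite -expRD addNr expR0.
have h4 := expR_gt0 (- x).
apply/andP; split; last lra.
(* For the lower bound, [exp(- x) <= 1 / (1 + x)] suffices because
   [(1 - x + x^2) (1 + x) = 1 + x^3 >= 1]. *)
nra.
Qed.

Lemma cvg_expR_difference_quotient (R : realType) (z : R) : 0 <= z ->
  n.+1%:R * (1 - expR (- (n.+1%:R^-1 * z))) @[n --> \oo] --> z.
Proof.
move=> z0.
apply: (@squeeze_cvgr _ _ _ _ (fun n => z - n.+1%:R^-1 * z ^+ 2) (fun=> z)).
- apply: nearW => n.
  have := @expR_difference_quotient_bounds R z n.+1%:R^-1 z0.
  by rewrite invrK; apply; rewrite invr_gt0.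
- rewrite -[X in _ --> X]subr0 -[X in _ --> _ - X](mul0r (z ^+ 2)).
  apply: cvgB; first exact: cvg_cst.
  by apply: cvgM; [exact: cvg_harmonic|exact: cvg_cst].
- exact: cvg_cst.
Qed.

(** * Nonnegative variables ordered by their Laplace transforms *)

Section laplace_order.
Context (R : realType) d (T : measurableType d) (P : probability T R).
Variables U V : T -> R.
Hypotheses (mU : measurable_fun setT U) (mV : measurable_fun setT V).
Hypotheses (U0 : forall w, 0 <= U w) (V0 : forall w, 0 <= V w).
Hypothesis laplaceUV : forall t, 0 < t ->
  (\int[P]_w (expR (- (t * V w)))%:E <= \int[P]_w (expR (- (t * U w)))%:E)%E.

Let measurable_1BexpR t (W : T -> R) : measurable_fun setT W ->
  measurable_fun setT (fun w => (1 - expR (- (t * W w)))%:E).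
Proof.
move=> mW; apply/measurable_EFinP; apply: measurable_funB => //.
by do 2 apply: measurableT_comp => //; exact: measurable_funM.
Qed.

Let oneB_expR_ge0 t z : 0 <= t -> 0 <= z -> 0 <= 1 - expR (- (t * z)) :> R.
Proof. by move=> t0 z0; rewrite subr_ge0 -expR0 ler_expR oppr_le0 mulr_ge0. Qed.

Let le_1BexpR t : 0 <= t ->
  (\int[P]_w (1 - expR (- (t * U w)))%:E <=
   \int[P]_w (1 - expR (- (t * V w)))%:E)%E.
Proof.
(* At [t = 0], outside the range of [laplaceUV], both integrands are the same constant. *)
rewrite le_eqVlt => /predU1P[<-|t0].
  under eq_integral do rewrite mul0r.
  by under [leRHS]eq_integral do rewrite mul0r.
apply: le_integral_1BexpR; [exact: measurable_funM..| | |exact: laplaceUV].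
- by move=> w; rewrite mulr_ge0// ltW.
- by move=> w; rewrite mulr_ge0// ltW.
Qed.

(** Only the approximants of [U] have to converge, which is where Fatou's lemma enters; those of [V]
    are merely bounded above by [V]. *)
Lemma laplace_order_mean :
  (\int[P]_w (U w)%:E <= \int[P]_w (V w)%:E)%E.
Proof.
pose f (W : T -> R) n w := (n.+1%:R * (1 - expR (- (n.+1%:R^-1 * W w))))%:E.
have mf W n : measurable_fun setT W -> measurable_fun setT (f W n).
  move=> mW; rewrite /f; under eq_fun do rewrite EFinM.
  by apply: measurable_funeM; exact: measurable_1BexpR.
have f0 n w : (0 <= f U n w)%E.
  by rewrite lee_fin mulr_ge0// oneB_expR_ge0// invr_ge0.
have -> : (\int[P]_w (U w)%:E = \int[P]_w limn_einf (f U ^~ w))%E.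
  apply: eq_integral => w _; apply/esym.
  have -> // := @cvg_limn_einf_sup _ (f U ^~ w) (U w)%:E.
  by apply: cvg_EFin; [exact: nearW|exact: cvg_expR_difference_quotient].
apply: le_trans (fatou _ _ _ _) _ => //; first by move=> n; exact: mf.
have le n : (\int[P]_w f U n w <= \int[P]_w (V w)%:E)%E.
  apply: (@le_trans _ _ (\int[P]_w f V n w)%E).
    rewrite /f; under eq_integral do rewrite EFinM.
    under [leRHS]eq_integral do rewrite EFinM.
    rewrite !ge0_integralZl_EFin//; try exact: measurable_1BexpR.
    - by rewrite lee_pmul2l// le_1BexpR// invr_ge0.
    - by move=> w _; rewrite lee_fin oneB_expR_ge0// invr_ge0.
    - by move=> w _; rewrite lee_fin oneB_expR_ge0// invr_ge0.
  apply: ge0_le_integral => //.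
  - by move=> w _; rewrite lee_fin mulr_ge0// oneB_expR_ge0// invr_ge0.
  - exact: mf.
  - exact/measurable_EFinP.
  - move=> w _; rewrite lee_fin.
    have n0 : (0 : R) < n.+1%:R^-1 by rewrite invr_gt0.
    have /andP[_] := expR_difference_quotient_bounds (V0 w) n0.
    by rewrite invrK.
(* The lower limit is at most the upper one, and each supremum over a tail is bounded by the mean of
   [V] thanks to [le]. *)
apply: (le_trans (limn_einf_sup _)).
rewrite limn_esup_lim.
apply: lime_le; first exact: is_cvg_esups.
apply: nearW => n; apply: ge_ereal_sup => _ [k _ <-]; exact: le.
Qed.

Let measurable_levy (W : T -> R) : measurable_fun setT W ->
  measurable_fun setT (fun z : T * R =>
    (1 - expR (- (Num.max z.2 0 * W z.1)))%:E).
Proof.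
move=> mW; apply/measurable_EFinP; apply: measurable_funB => //.
do 2 apply: measurableT_comp => //; apply: measurable_funM.
  exact: measurable_maxr.
exact: measurableT_comp.
Qed.

(* [Num.max t 0] makes the integrand vanish for [t <= 0], so that [m] may be
   integrated over the whole line. *)
Lemma laplace_order_levy (m : {sigma_finite_measure set R -> \bar R}) :
  (\int[P]_w \int[m]_t (1 - expR (- (Num.max t 0 * U w)))%:E <=
   \int[P]_w \int[m]_t (1 - expR (- (Num.max t 0 * V w)))%:E)%E.
Proof.
pose f (W : T -> R) (z : T * R) := (1 - expR (- (Num.max z.2 0 * W z.1)))%:E.
have mf (W : T -> R) : measurable_fun setT W -> measurable_fun setT (f W).
  exact: measurable_levy.
have f0 (W : T -> R) z : (forall w, 0 <= W w) -> (0 <= f W z)%E.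
  by move=> W0; rewrite lee_fin oneB_expR_ge0// le_max lexx orbT.
have sw (W : T -> R) : measurable_fun setT W -> (forall w, 0 <= W w) ->
    (\int[P]_w \int[m]_t f W (w, t) = \int[m]_t \int[P]_w f W (w, t))%E.
  by move=> mW W0; apply: fubini_tonelli => [|z]; [exact: mf|exact: f0].
rewrite [leLHS](sw U mU U0) [leRHS](sw V mV V0).
apply: ge0_le_integral; first exact: measurableT.
- by move=> t _; apply: integral_ge0 => w _; exact: f0.
- by apply: measurable_fun_fubini_tonelli_G; [exact: mf|move=> z; exact: f0].
- by apply: measurable_fun_fubini_tonelli_G; [exact: mf|move=> z; exact: f0].
(* After the exchange of integrals, only the comparison at the fixed rate [max(t, 0)] is left. *)
- move=> t _; apply: (@le_1BexpR (Num.max t 0)).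
  by rewrite le_max lexx orbT.
Qed.

Lemma laplace_order_bernstein (G : {nonneg R} -> {nonneg R})
    (U' V' : T -> {nonneg R}) : bernstein G ->
  (forall w, (U' w)%:num = U w) -> (forall w, (V' w)%:num = V w) ->
  (\int[P]_w ((G (U' w))%:num)%:E <= \int[P]_w ((G (V' w))%:num)%:E)%E.
Proof.
move=> [a [b [mu [a0 b0 mu_fin GE]]]] U'E V'E.
have mD := measurable_itv (Interval (BRight (0 : R)) +oo%O).
pose mu0 := mrestr mu mD.
have [m mE] : exists m : {sigma_finite_measure set R -> \bar R},
    forall A, m A = mu0 A.
  pose F := Measure_isSigmaFinite.Build _ _ _ mu0
    (sigma_finite_mrestr_gt0 mu_fin).
  pose m : {sigma_finite_measure set R -> \bar R} := HB.pack mu0 F.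
  by exists m.
pose I (W : T -> R) w := (\int[m]_t (1 - expR (- (Num.max t 0 * W w)))%:E)%E.
have I0 (W : T -> R) w : (forall w, 0 <= W w) -> (0 <= I W w)%E.
  move=> W0; apply: integral_ge0 => t _.
  by rewrite lee_fin oneB_expR_ge0// le_max lexx orbT.
have mI (W : T -> R) : measurable_fun setT W -> (forall w, 0 <= W w) ->
    measurable_fun setT (I W).
  move=> mW W0; apply: (measurable_fun_fubini_tonelli_F (fun z : T * R =>
    (1 - expR (- (Num.max z.2 0 * W z.1)))%:E)) => [|z].
    exact: measurable_levy.
  by rewrite lee_fin oneB_expR_ge0// le_max lexx orbT.
have GW (W : T -> R) (W' : T -> {nonneg R}) : measurable_fun setT W ->
    (forall w, 0 <= W w) -> (forall w, (W' w)%:num = W w) ->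
    (\int[P]_w ((G (W' w))%:num)%:E =
     a%:E + b%:E * \int[P]_w (W w)%:E + \int[P]_w I W w)%E.
  move=> mW W0 W'E.
  have Gw w : ((G (W' w))%:num%:E = a%:E + b%:E * (W w)%:E + I W w)%E.
    rewrite GE W'E; congr (_ + _)%E.
    (* [m] agrees with [mu] on subsets of []0, +oo[]; off that interval the integrand with
       [max(t, 0)] vanishes, so the domain can be enlarged to the whole line. *)
    transitivity (\int[m]_(t in `]0%R, +oo[) (1 - expR (- (t * W w)))%:E)%E.
      apply: eq_measure_integral => A mA AD.
      transitivity (mu0 A); last exact: (esym (mE A)).
      by rewrite /mu0 /mrestr setIidl.
    rewrite integral_mkcond; apply: eq_integral => t _; rewrite patchE.
    case: ifPn; rewrite ?notin_setE ?inE/= in_itv/= andbT.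
      by move=> t0; rewrite max_l// ltW.
    move=> /negP; rewrite -leNgt => t0.
    by rewrite max_r// mul0r oppr0 expR0 subrr.
  under eq_integral do rewrite Gw.
  rewrite ge0_integralD//; first last.
  - exact: mI.
  - by move=> w _; exact: I0.
  - apply: emeasurable_funD; first exact: measurable_cst.
    by apply: measurable_funeM; exact/measurable_EFinP.
  - by move=> w _; rewrite adde_ge0// mule_ge0// lee_fin.
  rewrite ge0_integralD//; first last.
  - by apply: measurable_funeM; exact/measurable_EFinP.
  - by move=> w _; rewrite mule_ge0// lee_fin.
  rewrite integral_cst// ge0_integralZl_EFin//; first last.
  - exact/measurable_EFinP.
  - by move=> w _; rewrite lee_fin.
  by rewrite [X in (_ * X)%E](_ : _ = 1%E) ?mule1//; exact: probability_setT.
rewrite (GW U U' mU U0 U'E) (GW V V' mV V0 V'E).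
apply: leeD; last exact: laplace_order_levy.
apply: leeD2l; apply: lee_wpmul2l; last exact: laplace_order_mean.
by rewrite lee_fin.
Qed.

End laplace_order.

Theorem theorem2 (R : realType) (G : {nonneg R} -> {nonneg R})
    (hG : bernstein G)
    (F : {nonneg R} -> {nonneg R} := fun l => G (l%:num ^+ 2)%:nng)
    (d : measure_display) (T : measurableType d) (P : probability T R)
    (X Y : {RV P >-> R})
    (indXY : independent_RV X Y) (idXY : identically_distributed X Y) :
  ('E_P[fun w => (F `|X w - Y w|%:nng)%:num%R]
     <= 'E_P[fun w => (F `|X w + Y w|%:nng)%:num%R])%E.
Proof.
rewrite unlock /F.
(* The squared difference is taken as [U]: it has the larger Laplace transform, hence the smaller
   expectation. *)
apply: (laplace_order_bernstein (U := fun w => (X w - Y w) ^+ 2)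
  (V := fun w => (X w + Y w) ^+ 2) _ _ _ _ _ hG).
- by apply: measurable_funX; exact: measurable_funB.
- by apply: measurable_funX; exact: measurable_funD.
- by move=> w; exact: sqr_ge0.
- by move=> w; exact: sqr_ge0.
- by move=> t; exact: laplace_sqr_add_le_sub.
- by move=> w; rewrite /= real_normK// num_real.
- by move=> w; rewrite /= real_normK// num_real.
Qed.
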